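(* Let $E$ be a compact Hausdorff space, let $x$ be a distinguished point, and let $\varphi\in C(E)$. Let $\mathcal A$ be a nonempty family of functions and $\mathcal F$ a convex cone of functions, each function $u$ in $\mathcal A$ or $\mathcal F$ having a value $u(x)\in\mathbb R$ at $x$ and a bounded upper semicontinuous trace $u_E$ on $E$. Assume: (i) $\mathcal A$ is convex and $(tu+(1-t)v)_E\le t u_E+(1-t)v_E$ for all $u,v\in\mathcal A$ and $0\le t\le 1$; (ii) $\mathcal A$ is invariant under addition of real constants, and $(u+a)_E=u_E+a$ for all $u\in\mathcal A$, $a\in\mathbb R$; (iii) if $u\in\mathcal A$, $v\in\mathcal F$ and $t\ge 0$, then $u+tv\in\mathcal A$ and $(u+tv)_E\le u_E+tv_E$. Assume that $P_{\mathcal A}\varphi(x)$ is finite. Then $$P_{\mathcal A}\varphi(x)=\inf_{\mu\in J_x^E(\mathcal F)}\left(\int_E\varphi\,d\mu-B_{\mathcal A}(x,\mu)\right).$$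
   Context: The functions are real-valued functions on a common set containing the point $x$ (at least, their value at $x$ is defined), with pointwise addition and scaling; the trace is an operation $u\mapsto u_E$ assigning to each such function a bounded upper semicontinuous function $u_E:E\to\mathbb R$. The point $x$ need not belong to $E$. $\mathcal P(E)$ denotes the set of (regular) Borel probability measures on $E$. The Jensen measures are $$J_x^E(\mathcal F)=\Big\{\mu\in\mathcal P(E): v(x)\le\int_E v_E\,d\mu\ \text{ for all } v\in\mathcal F\Big\}.$$ The envelope is $P_{\mathcal A}\varphi(x)=\sup\{u(x):u\in\mathcal A,\ u_E\le\varphi\}$. For a finite positive Borel measure $\mu$ on $E$, the Jensen deficit is $$B_{\mathcal A}(x,\mu)=\inf_{u\in\mathcal A}\Big(\int_E u_E\,d\mu-u(x)\Big)\in[-\infty,\infty).$$ If $B_{\mathcal A}(x,\mu)=-\infty$, then $\int_E\varphi\,d\mu-B_{\mathcal A}(x,\mu)=+\infty$. *)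

(* Defs.v *)
From mathcomp Require Import all_boot all_order all_algebra.
From mathcomp Require Import all_classical all_reals all_analysis.

Set Implicit Arguments.
Unset Strict Implicit.
Unset Printing Implicit Defensive.

Import Order.TTheory GRing.Theory Num.Theory.
Import numFieldNormedType.Exports.

Local Open Scope classical_set_scope.
Local Open Scope ring_scope.

(* Measurable types of MathComp-Analysis are pointed, whence [ptopologicalType].
   This only excludes the empty space, on which there is no probability
   measure and every envelope of a nonempty family stable under addition of
   constants is +oo. *)
Definition borel (E : ptopologicalType) := g_sigma_algebraType (@open E).

Definition regular (R : realType) (E : ptopologicalType)
    (mu : {measure set (borel E) -> \bar R}) : Prop :=
  forall B : set (borel E), measurable B ->
    mu B = ereal_inf [set mu U | U in [set U : set E | open U /\ B `<=` U]] /\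
    mu B = ereal_sup [set mu K | K in [set K : set E | compact K /\ K `<=` B]].

Definition upper_semicontinuous (R : realType) (E : topologicalType)
    (f : E -> R) : Prop :=
  forall e (a : R), f e < a -> \forall y \near e, f y < a.

(* The vertex 0 is not required to belong to the cone. *)
Definition convex_cone (R : realType) (V : lmodType R) (F : set V) : Prop :=
  convex_set F /\ forall (t : R) v, 0 < t -> F v -> F (t *: v).

Section jensen.
Context {R : realType} {X : Type} {E : ptopologicalType}.
(* [tr u] is the trace u_E; only its values on the families below matter. *)
Variables (tr : (X -> R^o) -> E -> R) (x : X).

Definition jensen_measures (F : set (X -> R^o)) : set (probability (borel E) R) :=
  [set mu | regular mu /\
     forall v, F v -> ((v x)%:E <= \int[mu]_e (tr v e)%:E)%E].

Definition envelope (A : set (X -> R^o)) (phi : E -> R) : \bar R :=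
  ereal_sup [set (u x)%:E | u in [set u | A u /\ forall e, tr u e <= phi e]].

Definition jensen_deficit (A : set (X -> R^o))
    (mu : {finite_measure set (borel E) -> \bar R}) : \bar R :=
  ereal_inf [set (\int[mu]_e (tr u e)%:E - (u x)%:E)%E | u in A].

End jensen.

(* Main.v *)
(** The envelope [q f] of [f] at [x] is a concave, monotone function of [f] in
    C(E) with [q (f + a) = q f + a].  By Hahn-Banach it has a linear
    supergradient [L] at [phi], which is a positive functional with [L 1 = 1],
    hence the integral against a regular Borel probability measure [mu] by
    Riesz-Markov.  For [u] in [A] and [f >= u_E] continuous, [u x <= q f <=
    q phi - L phi + L f].  Since [u_E] is upper semicontinuous, the infimum of
    [L f] over such [f] is the integral of [u_E], so that the deficit of [mu] is
    at least [L phi - q phi].  Replacing [u] by [u + t v] and letting [t] tend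
    to infinity shows that [mu] is a Jensen measure, which gives one inequality.
    The other one is immediate from the definitions. *)

From HB Require Import structures.
Require Import Defs.
From mathcomp Require Import all_boot all_order all_algebra finmap.
From mathcomp Require Import all_classical all_reals all_analysis.
From mathcomp Require Import ring lra.

Import Order.TTheory GRing.Theory Num.Theory.
Import numFieldNormedType.Exports.

Set Implicit Arguments.
Unset Strict Implicit.
Unset Printing Implicit Defensive.

Local Open Scope classical_set_scope.
Local Open Scope ring_scope.

(** * Linear minorants of convex functions *)

Section hahn_banach.
Context {R : realType} {V : lmodType R}.
(** A subspace given by a predicate: later it is the set of continuous functions inside [E -> R^o],
    and properties of functionals are stated on it only. *)
Variable D : set V.
Hypothesis D_lin : forall (a : R) u v, D u -> D v -> D (a *: u + v).
Hypothesis D0 : D 0.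

Definition convex_on (h : V -> R) := forall u v (t : R), D u -> D v ->
  0 <= t <= 1 -> h (t *: u + (1 - t) *: v) <= t * h u + (1 - t) * h v.

Let DZ a u : D u -> D (a *: u).
Proof. by move=> Du; rewrite -[_ *: _]addr0; exact: D_lin. Qed.

Let DD u v : D u -> D v -> D (u + v).
Proof. by move=> Du Dv; rewrite -[u]scale1r; exact: D_lin. Qed.

Let Dconv (t : R) u v : D u -> D v -> D (t *: u + (1 - t) *: v).
Proof. by move=> Du Dv; apply: D_lin => //; exact: DZ. Qed.

(** Convexity at 0, the midpoint of [u] and [- u]. It bounds the members of a chain from below in
    the Zorn argument. *)
Let convex_opp h u : convex_on h -> h 0 = 0 -> D u -> - h (- u) <= h u.
Proof.
move=> ch h0 Du.
have := ch u (- u) (2^-1) Du.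
rewrite -scaleN1r => /(_ (DZ _ Du)).
have -> : 0 <= (2^-1 : R) <= 1 by lra.
move=> /(_ isT).
have -> : 2^-1 *: u + (1 - 2^-1) *: (-1 *: u) = 0.
  rewrite scalerA -scalerDl (_ : _ + _ = 0) ?scale0r//; lra.
rewrite h0; lra.
Qed.

(* The slope [a] is the one-sided derivative of [h] at 0 along [y]. *)
Let convex_line h y : convex_on h -> h 0 = 0 -> D y ->
  exists a, forall t, t * a <= h (t *: y).
Proof.
move=> ch h0 Dy.
(* 0 is a convex combination of [t *: y] and [- s *: y], so left slopes lie below right slopes. *)
have key (s t : R) : 0 < s -> 0 < t -> - (h (- s *: y) / s) <= h (t *: y) / t.
  move=> s0 t0; have st0 : 0 < s + t by exact: addr_gt0.
  have := ch (t *: y) (- s *: y) (s / (s + t)) (DZ _ Dy) (DZ _ Dy).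
  rewrite divr_ge0 ?(ltW s0) ?(ltW st0)//= ler_pdivrMr// mul1r lerDl ltW//.
  move=> /(_ isT).
  have -> : 1 - s / (s + t) = t / (s + t) by field; rewrite gt_eqF.
  have -> : s / (s + t) *: (t *: y) + t / (s + t) *: (- s *: y) = 0.
    rewrite !scalerA -scalerDl (_ : _ + _ = 0) ?scale0r//; ring.
  rewrite h0 => H.
  have H2 : 0 <= s * h (t *: y) + t * h (- s *: y).
    have := mulr_ge0 (ltW st0) H; congr (_ <= _); field; by rewrite gt_eqF.
  rewrite -subr_ge0.
  have -> : h (t *: y) / t - - (h (- s *: y) / s) =
    (s * h (t *: y) + t * h (- s *: y)) / (s * t).
    by field; rewrite !gt_eqF.
  by rewrite divr_ge0// mulr_ge0// ltW.
pose S := [set h (t *: y) / t | t in [set t : R | 0 < t]].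
have lbS (s : R) : 0 < s -> lbound S (- (h (- s *: y) / s)).
  by move=> s0 _ [t /= t0 <-]; exact: key.
exists (inf S) => t.
have [t0|t0|->] := ltgtP t 0; last by rewrite mul0r scale0r h0.
- have : - (h (- (- t) *: y) / (- t)) <= inf S.
    apply: lb_le_inf; last by apply: lbS; rewrite oppr_gt0.
    by exists (h (1 *: y) / 1), 1 => //=.
  rewrite opprK invrN mulrN opprK ler_ndivrMr//.
  by rewrite mulrC.
- have : inf S <= h (t *: y) / t.
    apply: ge_inf; last by exists t.
    by exists (- (h (- 1 *: y) / 1)); exact: lbS.
  by rewrite ler_pdivlMr// mulrC.
Qed.

(* [k u] is the infimum of [h (u + t *: y) - t * a] over [t], for [a] the slope
   given by [convex_line]. *)
Let convex_descent h y : convex_on h -> h 0 = 0 -> D y ->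
  exists k a, [/\ convex_on k, k 0 = 0 & forall u t, D u ->
    k u <= h (u + t *: y) - t * a].
Proof.
move=> ch h0 Dy; have [a ha] := convex_line ch h0 Dy.
pose S u := [set h (u + t *: y) - t * a | t in [set: R]].
have S0 u : S u !=set0 by exists (h (u + 0 *: y) - 0 * a), 0.
have lbS u : D u -> lbound (S u) (- h (- u)).
  move=> Du _ [t _ <-].
  (* The midpoint of [u + t *: y] and [- u] is [(t / 2) *: y], where [h] is at least [t / 2 * a]. *)
  have := ch (u + t *: y) (- u) (2^-1).
  have DNu : D (- u) by rewrite -scaleN1r; exact: DZ.
  move=> /(_ (DD Du (DZ _ Dy)) DNu).
  have -> : 0 <= (2^-1 : R) <= 1 by lra.
  move=> /(_ isT).
  have -> : 1 - 2^-1 = 2^-1 :> R by lra.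
  rewrite -scalerDr addrAC subrr add0r scalerA => H.
  have := le_trans (ha (2^-1 * t)) H; lra.
have hiS u : D u -> has_inf (S u).
  by move=> Du; split => //; exists (- h (- u)); exact: lbS.
exists (fun u => inf (S u)), a; split.
- move=> u v t Du Dv /andP[t0 t1].
  apply/ler_addgt0Pr => e e0.
  have [_ [r _ <-] ur] := inf_adherent e0 (hiS u Du).
  have [_ [s _ <-] vs] := inf_adherent e0 (hiS v Dv).
  (* Near-minimizers [r] at [u] and [s] at [v] combine to a candidate for the infimum at the convex
     combination. *)
  apply: (@le_trans _ _ (h (t *: (u + r *: y) + (1 - t) *: (v + s *: y)) -
      (t * r + (1 - t) * s) * a)).
    apply: ge_inf; first by have [] := hiS _ (Dconv t Du Dv).
    exists (t * r + (1 - t) * s) => //; congr (h _ - _).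
    by rewrite !scalerDr !scalerA (scalerDl y) addrACA.
  have := ch (u + r *: y) (v + s *: y) t (DD Du (DZ _ Dy)) (DD Dv (DZ _ Dy)).
  rewrite t0 t1 => /(_ isT); nra.
- apply/eqP; rewrite eq_le; apply/andP; split.
    apply: ge_inf; first by have [] := hiS 0 D0.
    by exists 0 => //; rewrite scale0r addr0 h0 mul0r subr0.
  by apply: lb_le_inf => // _ [t _ <-]; rewrite add0r subr_ge0.
- by move=> u t Du; apply: ge_inf; [have [] := hiS u Du | exists t].
Qed.

(* A minimal convex function among those below [G] that vanish at 0 is linear:
   by [convex_descent] it is affine along every line. *)
Lemma convex_linear_minorant (G : V -> R) : convex_on G -> G 0 = 0 ->
  exists L : V -> R, [/\ forall u v, D u -> D v -> L (u + v) = L u + L v,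
    forall a u, D u -> L (a *: u) = a * L u & forall u, D u -> L u <= G u].
Proof.
move=> cG G0.
pose P (h : V -> R) := [/\ convex_on h, h 0 = 0 & forall u, D u -> h u <= G u].
pose T := {h : V -> R | P h}.
(* The order is reversed, so that a maximal element for Zorn's lemma is a minimal function. *)
pose below (h k : T) := `[< forall u, D u -> sval k u <= sval h u >].
have PG : P G by split.
have [| | |[h [ch h0 hG]] hmin] := @ZL_preorder T (exist _ G PG) below.
- by move=> h; apply/asboolP.
- move=> h k l /asboolP hk /asboolP kl; apply/asboolP => u Du.
  exact: le_trans (kl u Du) (hk u Du).
- move=> C Ctot; have [->|/set0P C0] := eqVneq C set0.
    by exists (exist _ G PG).
  pose S u := [set sval h u | h in C].
  have hiS u : D u -> has_inf (S u).
    move=> Du; split; first by have [h Ch] := C0; exists (sval h u), h.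
    exists (- G (- u)) => _ [[h [ch h0 hG]] _ <-] /=.
    apply: le_trans (convex_opp ch h0 Du); rewrite lerN2; apply: hG.
    by rewrite -scaleN1r; exact: DZ.
  have Pinf : P (fun u => inf (S u)).
    split.
    + move=> u v t Du Dv t01.
      apply/ler_addgt0Pr => e e0.
      have [_ [h Ch <-] uh] := inf_adherent e0 (hiS u Du).
      have [_ [k Ck <-] vk] := inf_adherent e0 (hiS v Dv).
      (* The smaller of [h] and [k] in the chain is nearly optimal at both points, so the infimum
         stays convex. *)
      have [l [Cl lh lk]] : exists l, [/\ C l,
          forall w, D w -> sval l w <= sval h w
          & forall w, D w -> sval l w <= sval k w].
        by have [/asboolP ?|/asboolP ?] := Ctot h k Ch Ck; [exists k|exists h].
      apply: (@le_trans _ _ (sval l (t *: u + (1 - t) *: v))).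
        by apply: ge_inf; [have [] := hiS _ (Dconv t Du Dv)|exists l].
      have [cl _ _] := svalP l.
      have := cl u v t Du Dv t01; have := lh u Du; have := lk v Dv.
      move: t01 => /andP[? ?]; nra.
    + rewrite (_ : S 0 = [set 0]) ?inf1//.
      apply/seteqP; split => [_ [[h [? ? ?]] _ <-]//|_ ->].
      by have [h Ch] := C0; exists h => //; case: (svalP h).
    + move=> u Du; have [h Ch] := C0; have [_ _ hG] := svalP h.
      apply: le_trans (hG u Du); apply: ge_inf; last by exists h.
      by have [] := hiS u Du.
  exists (exist _ _ Pinf) => h Ch; apply/asboolP => u Du /=.
  by apply: ge_inf; [have [] := hiS u Du|exists h].
have affine y : D y ->
    exists a, forall u t, D u -> h (u + t *: y) = h u + t * a.
  move=> Dy; have [k [a [ck k0 kh]]] := convex_descent ch h0 Dy.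
  have Pk : P k.
    split => // u Du; apply: le_trans (hG u Du).
    by have := kh u 0 Du; rewrite scale0r addr0 mul0r subr0.
  have /asboolP/= hk : below (exist _ k Pk) (exist _ h (And3 ch h0 hG)).
    apply: hmin; apply/asboolP => u Du /=.
    by have := kh u 0 Du; rewrite scale0r addr0 mul0r subr0.
  have le u t : D u -> h u <= h (u + t *: y) - t * a.
    by move=> Du; exact: le_trans (hk u Du) (kh u t Du).
  (* [le] at [u] gives one inequality; at [u + t *: y] with parameter [- t] it gives the other. *)
  exists a => u t Du; apply/eqP; rewrite eq_le; apply/andP; split.
    have := le (u + t *: y) (- t) (DD Du (DZ _ Dy)).
    by rewrite scaleNr addrK mulNr opprK.
  by have := le u t Du; lra.
exists h; split => //.
- move=> u v Du Dv; have [a ha] := affine v Dv.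
  have := ha u 1 Du; rewrite scale1r mul1r => ->.
  by have := ha 0 1 D0; rewrite scale1r add0r mul1r h0 add0r => ->.
- move=> c v Dv; have [a ha] := affine v Dv.
  have := ha 0 c D0; rewrite add0r h0 add0r => ->.
  by have := ha 0 1 D0; rewrite scale1r add0r mul1r h0 add0r => ->.
Qed.

End hahn_banach.

(** * Upper semicontinuous functions *)

Lemma usc_closed (R : realType) (E : topologicalType) (g : E -> R) (a : R) :
  upper_semicontinuous g -> closed [set e | a <= g e].
Proof.
move=> ug; rewrite -openC openE => e /= /negP; rewrite -ltNge => /ug.
by apply: filterS => e'; rewrite ltNge => /negP.
Qed.

Lemma continuous_usc (R : realType) (E : topologicalType) (g : E -> R) :
  continuous g -> upper_semicontinuous g.
Proof. by move=> cg e a ga; exact: (cvgr_lt _ (cg e)). Qed.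

Lemma usc_measurable (R : realType) (E : ptopologicalType) (g : E -> R) :
  upper_semicontinuous g -> measurable_fun setT (g : borel E -> R).
Proof.
move=> ug.
apply: (measurability _ (measurable_realfun.RGenInftyO.measurableE R)).
move=> _ [_ [a ->]] <-; rewrite setTI preimage_itvNyo.
apply: sub_sigma_algebra; rewrite /= -closedC.
rewrite (_ : ~` _ = [set e | a <= g e]); first exact: usc_closed.
by apply/seteqP; split => e /=; rewrite leNgt => /negP.
Qed.

Lemma continuous_bounded (R : realType) (E : topologicalType) (f : E -> R^o) :
  compact [set: E] -> continuous f -> exists M, forall e, `|f e| <= M.
Proof.
move=> E_compact cf.
have /compact_bounded[M [_ bM]] : compact (f @` setT).
  by apply: continuous_compact => //; exact: continuous_subspaceT.
by exists (M + 1) => e; apply: (bM (M + 1)); [rewrite ltrDl|exists e].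
Qed.

Lemma usc_integrable (R : realType) (E : ptopologicalType)
    (mu : {finite_measure set (borel E) -> \bar R}) (g : E -> R) :
  upper_semicontinuous g -> [bounded g e | e in setT] ->
  mu.-integrable setT (EFin \o (g : borel E -> R)).
Proof.
move=> ug bg; apply: measurable_bounded_integrable => //.
  by rewrite ltey_eq fin_num_measure.
exact: usc_measurable.
Qed.

Lemma integral_usc (R : realType) (E : ptopologicalType)
    (mu : {finite_measure set (borel E) -> \bar R}) (g : E -> R) :
  upper_semicontinuous g -> [bounded g e | e in setT] ->
  (\int[mu]_e (g e)%:E)%E = (\int[mu]_e g e)%:E.
Proof.
move=> ug bg; rewrite /Rintegral fineK//; apply: integrable_fin_num => //.
exact: usc_integrable.
Qed.

(** Discrete layer-cake formula: for level sets at equally spaced heights, a multiple of this sum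
    approximates the function. *)
Definition staircase (R : realType) (T : Type) (K : nat -> set T) (N : nat)
  (e : T) : R := \sum_(k < N) \1_(K k) e.

(** [S] is the minimum of [N] and [floor (y / d) + 1], the term [k = 0] always counting. Thus
    [S * d] exceeds [y] by at most [d], and falls below [y] only by truncation at [N]. *)
Lemma staircase_bounds (R : realType) (d y : R) (N : nat) :
  0 < d -> 0 <= y ->
  let S : R := \sum_(k < N) (k%:R * d <= y)%R%:R in
  [/\ S <= N%:R, S * d <= y + d & y <= S * d \/ S = N%:R].
Proof.
move=> d0 y0; elim: N => [|N [IH1 IH2 IH3]] /=.
  by rewrite big_ord0; split; [|rewrite mul0r addr_ge0// ltW|right].
rewrite big_ord_recr /=; set S := \sum_(k < N) _ in IH1 IH2 IH3 *.
have [Ny|Ny] := leP (N%:R * d) y; rewrite /= ?addr0 ?mulr1n -natr1.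
split; [by rewrite lerD2r| |].
    by rewrite mulrDl mul1r lerD2r (le_trans _ Ny)// ler_pM2r.
  case: IH3 => [yS|->]; [left|by right].
  by rewrite (le_trans yS)// ler_pM2r// lerDl.
split; [by rewrite (le_trans IH1)// lerDl|by []|left].
by case: IH3 => // ->; exact: ltW.
Qed.

(** * The Riesz-Markov theorem *)

(* Only the values of [L] on continuous functions matter. *)
Definition mean (R : realType) (E : topologicalType) (L : (E -> R^o) -> R) :=
  [/\ forall f g, continuous f -> continuous g -> L (f + g) = L f + L g,
      forall (a : R) f, continuous f -> L (a *: f) = a * L f,
      forall f g, continuous f -> continuous g -> (forall e, f e <= g e) ->
        L f <= L g
    & L (cst 1) = 1].

Section riesz.
Context {R : realType} {E : ptopologicalType}.
Hypotheses (E_compact : compact [set: E]) (E_hausdorff : hausdorff_space E).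
Variable L : (E -> R^o) -> R.
Hypothesis L_mean : mean L.
Implicit Types (f g : E -> R^o) (U V : set E).

Let cst_cont (a : R) : continuous (cst a : E -> R^o).
Proof. by move=> e; exact: cvg_cst. Qed.

Let add_cont f g : continuous f -> continuous g -> continuous (f + g).
Proof. by move=> cf cg e; apply: cvgD; [exact: cf|exact: cg]. Qed.

Let scale_cont (a : R) f : continuous f -> continuous (a *: f).
Proof. by move=> cf e; apply: (@continuousZl_tmp R R^o); exact: cf. Qed.

Let LD f g : continuous f -> continuous g -> L (f + g) = L f + L g.
Proof. by case: L_mean => + _ _ _; exact. Qed.

Let LZ (a : R) f : continuous f -> L (a *: f) = a * L f.
Proof. by case: L_mean => _ + _ _; exact. Qed.

Let L_le f g : continuous f -> continuous g -> (forall e, f e <= g e) ->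
  L f <= L g.
Proof. by case: L_mean => _ _ + _; exact. Qed.

Let L_cst (a : R) : L (cst a) = a.
Proof.
have -> : cst a = a *: (cst 1 : E -> R^o).
  by apply/funext => e; exact/esym/mulr1.
by rewrite LZ; [case: L_mean => _ _ _ ->; rewrite mulr1|exact: cst_cont].
Qed.

(** * The mass of open sets *)

Let below U :=
  [set f : E -> R^o | continuous f /\ forall e, f e <= (\1_U e : R)].

(** For a competitor [f] and [d > 0], the level set [f >= d] is compact and lies in [U]; it takes
    over the role of a compact support. *)
Definition open_mass U : R := sup [set L f | f in below U].

Let mass_sup U : has_sup [set L f | f in below U].
Proof.
split.
  by exists (L (cst 0)), (cst 0).
exists 1 => _ [f [cf f1] <-]; rewrite -(L_cst 1); apply: L_le => //.
by move=> e; rewrite (le_trans (f1 e))// indicE lern1 leq_b1.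
Qed.

Let mass_ub U f : continuous f -> (forall e, f e <= (\1_U e : R)) ->
  L f <= open_mass U.
Proof. by move=> cf fU; apply: ub_le_sup; [case: (mass_sup U)|exists f]. Qed.

Let mass_adherent U (d : R) : 0 < d ->
  exists f, [/\ continuous f, forall e, f e <= (\1_U e : R)
    & open_mass U <= L f + d].
Proof.
move=> d0; have [_ [f [cf fU] <-] lt] := sup_adherent d0 (mass_sup U).
by exists f; split => //; rewrite -lerBlDr ltW.
Qed.

Let mass_ge0 U : 0 <= open_mass U.
Proof.
rewrite -(L_cst 0); apply: mass_ub; first exact: cst_cont.
by move=> e; rewrite /= indicE ler0n.
Qed.

Let mass_le U V : U `<=` V -> open_mass U <= open_mass V.
Proof.
move=> UV; apply/ler_addgt0Pr => d d0.
have [f [cf fU /le_trans]] := mass_adherent U d0; apply.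
rewrite lerD2r; apply: mass_ub => // e; apply: le_trans (fU e) _.
rewrite !indicE ler_nat; have [eU|//] := boolP (e \in U).
by rewrite mem_set//; apply: UV; exact: set_mem.
Qed.

Let mass0 : open_mass set0 = 0.
Proof.
apply/eqP; rewrite eq_le mass_ge0 andbT; apply/ler_addgt0Pr => d d0.
have [f [cf f0 /le_trans]] := mass_adherent set0 d0; apply.
rewrite add0r gerDr -(L_cst 0); apply: L_le => // e.
by have := f0 e; rewrite indicE in_set0.
Qed.

Let massT : open_mass setT = 1.
Proof.
apply/eqP; rewrite eq_le; apply/andP; split.
  apply/ler_addgt0Pr => d d0.
  have [f [cf f1 /le_trans]] := mass_adherent setT d0; apply.
  rewrite lerD2r -(L_cst 1); apply: L_le => // e.
  by have := f1 e; rewrite indicT.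
rewrite -{1}(L_cst 1); apply: mass_ub => [|e]; first exact: cst_cont.
by rewrite indicT.
Qed.

Let closed_level f (d : R) : continuous f -> closed [set e | d <= f e].
Proof. by move=> cf; exact/usc_closed/continuous_usc. Qed.


(** Urysohn's lemma: a compact Hausdorff space is normal. *)
Let separation (A B : set E) : closed A -> closed B -> A `&` B = set0 ->
  exists s : E -> R^o, [/\ continuous s, forall e, 0 <= s e <= 1,
    forall e, A e -> s e = 0 & forall e, B e -> s e = 1].
Proof.
move=> cA cB AB0.
have := (@normal_separatorP R E).1 (compact_normal E_hausdorff E_compact) A B.
move=> /(_ cA cB AB0)/(@uniform_separatorP _ R)[s [cs s01 sA sB]].
exists s; split => //.
- by move=> e; have := s01 (s e); rewrite /= in_itv/=; apply; exists e.
- by move=> e Ae; apply: sA; exists e.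
- by move=> e Be; apply: sB; exists e.
Qed.

(* The witnesses are [s * w] and [(1 - s) * w], where [w] is the positive part
   of [f - d] and [s] is a Urysohn function separating [K `\` U] from [K `\` V],
   for [K] the level set [f >= d]. *)
Let massU U V : open U -> open V ->
  open_mass (U `|` V) <= open_mass U + open_mass V.
Proof.
move=> oU oV; apply/ler_addgt0Pr => d0 d0_gt0.
(* One half is lost by taking a near-optimal [f], the other by replacing [f] with the positive part
   of [f - d]. *)
pose d := d0 / 2; have d_gt0 : 0 < d by rewrite divr_gt0.
have [f [cf fUV /le_trans]] := mass_adherent (U `|` V) d_gt0; apply.
pose K := [set e | d <= f e].
have cK : closed K := closed_level cf.
have KUV e : K e -> U e \/ V e.
  move=> Ke; apply: contrapT => nUV; have := fUV e.
  by rewrite indicE memNset// leNgt => /negP; apply; exact: lt_le_trans Ke.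
have [|||s [cs s01 s0 s1]] := @separation (K `\` U) (K `\` V).
- by rewrite setDE; apply: closedI => //; exact: open_closedC.
- by rewrite setDE; apply: closedI => //; exact: open_closedC.
- by rewrite -subset0 => e [[Ke nUe] [_ nVe]]; have [] := KUV e Ke.
pose w : E -> R^o := (f + cst (- d)) \max cst 0.
have cw : continuous w.
  move=> e; apply: continuous_max; last exact: cst_cont.
  by exact: add_cont.
have w_ge0 e : 0 <= w e by rewrite le_max lexx orbT.
have w_le1 e : w e <= 1.
  rewrite ge_max ler01 andbT /=.
  have : f e <= 1 by rewrite (le_trans (fUV e))// indicE lern1 leq_b1.
  by rewrite !fctE; lra.
have w_out e : ~ K e -> w e = 0.
  by move=> /negP; rewrite -ltNge => fd; apply/max_idPr; rewrite !fctE; lra.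
pose g : E -> R^o := s \* w.
pose h : E -> R^o := (cst 1 - s) \* w.
have ct : continuous (cst 1 - s : E -> R^o).
  by move=> e; apply: cvgB; [exact: cvg_cst|exact: cs].
have cg : continuous g by move=> e; apply: continuousM; [exact: cs|exact: cw].
have ch : continuous h by move=> e; apply: continuousM; [exact: ct|exact: cw].
have gU e : g e <= (\1_U e : R).
  rewrite indicE; have [Ue|nUe] := boolP (e \in U).
    by have /andP[? ?] := s01 e; rewrite mulr_ile1.
  have [Ke|/w_out we] := pselect (K e); last by rewrite /g /= we mulr0.
  by rewrite /g /= s0 ?mul0r//; split => //; rewrite -notin_setE.
have hV e : h e <= (\1_V e : R).
  rewrite indicE /h !fctE /=; have /andP[? ?] := s01 e.
  have [Ve|nVe] := boolP (e \in V); first by rewrite mulr_ile1//; lra.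
  have [Ke|/w_out ->] := pselect (K e); last by rewrite mulr0.
  rewrite s1; last by split => //; rewrite -notin_setE.
  by rewrite subrr mul0r.
(* [g + h] is [w], which is at least [f - d]. *)
have : L f <= L (g + h + cst d).
  apply: L_le => //; first by do 2?apply: add_cont.
  move=> e; have : f e - d <= w e by rewrite le_max !fctE lexx.
  rewrite /g /h !fctE /=; lra.
rewrite !LD ?L_cst//; last exact: add_cont.
have := mass_ub cg gU; have := mass_ub ch hV; rewrite /d; lra.
Qed.

Let mass_bigsetU (F : nat -> set E) n : (forall i, open (F i)) ->
  open_mass (\big[setU/set0]_(i < n) F i) <= \sum_(i < n) open_mass (F i).
Proof.
move=> oF; elim: n => [|n IH]; first by rewrite !big_ord0 mass0.
rewrite !big_ord_recr /=; apply: le_trans (massU _ _) _ => //.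
  by apply: big_ind => //; [exact: open0|exact: openU].
by rewrite lerD2r.
Qed.

(** [f - d] is a competitor for [U], and [L] sends the constant [d] to [d]. *)
Let mass_shift U f (d : R) : continuous f ->
  (forall e, f e <= (\1_U e : R) + d) -> L f <= open_mass U + d.
Proof.
move=> cf fU; rewrite -lerBlDr -[X in _ - X]L_cst.
have -> : L f - L (cst d) = L (f + cst (- d)).
  by rewrite LD ?L_cst//; exact: cst_cont.
apply: mass_ub; first by exact: add_cont.
by move=> e; rewrite fctE lerBlDr; exact: fU.
Qed.

(** For a near-optimal [f], the compact set where [f >= d / 2] is covered by finitely many [F i],
    and [f] is below [d / 2] elsewhere. Finite subadditivity then applies up to an error [d]. *)
Let mass_bigcup (F : nat -> set E) : (forall i, open (F i)) ->
  ((open_mass (\bigcup_i F i))%:E <= \sum_(i <oo) (open_mass (F i))%:E)%E.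
Proof.
move=> oF; apply/lee_addgt0Pr => d d0; have d2 : 0 < d / 2 by rewrite divr_gt0.
have [f [cf fF Lf]] := mass_adherent (\bigcup_i F i) d2.
pose K := [set e | d / 2 <= f e].
have : cover_compact K.
  rewrite -compact_cover; apply: (subclosed_compact _ E_compact) => //.
  exact: closed_level.
move=> /(_ nat setT F (fun i _ => oF i)) [|D _ KD].
  move=> e Ke; apply: contrapT => nF; have := fF e.
  by rewrite indicE memNset// leNgt => /negP; apply; exact: lt_le_trans Ke.
pose n := (\max_(i <- D) i).+1.
have KF : K `<=` \big[setU/set0]_(i < n) F i.
  move=> e /KD[i /= iD Fie]; rewrite -bigcup_mkord.
  exists i => //=; rewrite ltnS.
  exact: (@leq_bigmax_seq _ (enum_fset D) xpredT id i).
have : L f <= open_mass (\big[setU/set0]_(i < n) F i) + d / 2.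
  apply: mass_shift => // e; rewrite indicE.
  have [Ke|/negP] := pselect (K e).
    rewrite mem_set; last exact: KF.
    have := fF e; rewrite indicE; case: (_ \in _) => /=; lra.
  by rewrite -ltNge => /ltW/le_trans; apply; rewrite lerDr ler0n.
move=> /le_trans/(_ (lerD (mass_bigsetU n oF) (lexx _))) Lf2.
apply: (@le_trans _ _ ((\sum_(i < n) open_mass (F i))%:E + d%:E)%E).
  rewrite -EFinD lee_fin; lra.
rewrite leeD2r// -sumEFin -(big_mkord xpredT (fun i => (open_mass (F i))%:E)).
by apply: nneseries_lim_ge => i _ _; rewrite lee_fin mass_ge0.
Qed.

(** * The outer measure and its Caratheodory measurable sets *)

Definition outer_mass (A : set E) : \bar R :=
  ereal_inf [set (open_mass U)%:E | U in [set U | open U /\ A `<=` U]].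

Let outer_open U : open U -> outer_mass U = (open_mass U)%:E.
Proof.
move=> oU; apply/eqP; rewrite eq_le; apply/andP; split.
  by rewrite /outer_mass; apply: ereal_inf_lbound; exists U => //; split => //.
rewrite /outer_mass; apply: le_ereal_inf_tmp => _ [V [oV UV] <-].
by rewrite lee_fin mass_le.
Qed.

Let outer_ub A U : open U -> A `<=` U -> (outer_mass A <= (open_mass U)%:E)%E.
Proof.
by move=> oU AU; rewrite /outer_mass; apply: ereal_inf_lbound; exists U.
Qed.

Let outer_ge0 A : (0 <= outer_mass A)%E.
Proof.
rewrite /outer_mass; apply: le_ereal_inf_tmp => _ [V [oV UV] <-].
by rewrite lee_fin.
Qed.

Let outer_fin A : outer_mass A \is a fin_num.
Proof.
rewrite ge0_fin_numE//; apply: le_lt_trans (ltry 1).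
by rewrite -massT; apply: outer_ub => //; exact: openT.
Qed.

Let outer_adherent A (d : R) : 0 < d ->
  exists U, [/\ open U, A `<=` U & ((open_mass U)%:E <= outer_mass A + d%:E)%E].
Proof.
move=> d0; have [_ [U [oU AU] <-] lt] := lb_ereal_inf_adherent d0 (outer_fin A).
by exists U; split => //; exact: ltW.
Qed.

Let outer0 : outer_mass set0 = 0%E.
Proof. by rewrite outer_open ?mass0//; exact: open0. Qed.

Let outer_le : {homo outer_mass : A B / A `<=` B >-> (A <= B)%E}.
Proof.
move=> A B AB; rewrite /outer_mass; apply: le_ereal_inf_tmp => _ [V [oV BV] <-].
by apply: outer_ub => //; exact: subset_trans BV.
Qed.

Let outer_subadd : sigma_subadditive outer_mass.
Proof.
move=> F; apply/lee_addgt0Pr => d d0.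
have dn n : 0 < d / (2 ^ n.+1)%:R by rewrite divr_gt0// ltr0n expn_gt0.
have /choice[U FU] n := outer_adherent (F n) (dn n).
apply: (@le_trans _ _ (open_mass (\bigcup_n U n))%:E).
  apply: outer_ub; first by apply: bigcup_open => n _; case: (FU n).
  by apply: subset_bigcup => n _; case: (FU n).
apply: le_trans (mass_bigcup _) _; first by move=> n; case: (FU n).
apply: le_trans (epsilon_trick _ _ (ltW d0)); last first.
  by move=> n; exact: outer_ge0.
apply: lee_nneseries => [n _ _|n _]; first by rewrite lee_fin.
by case: (FU n).
Qed.

HB.instance Definition _ := isOuterMeasure.Build R E outer_mass
  outer0 outer_ge0 outer_le outer_subadd.

(** Take [f] near-optimal for the intersection of [V] and [U], [K] the set [f >= d / 3], and [g]
    near-optimal for [V] minus [K], which contains [V] minus [U]. On [K] one has [g <= 0], and off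
    [K] one has [f < d / 3], so [f + g] is at most the indicator of [V] plus [d / 3]. *)
Let outer_split U V : open U -> open V ->
  (outer_mass (V `&` U) + outer_mass (V `&` ~` U) <= (open_mass V)%:E)%E.
Proof.
move=> oU oV; rewrite -(fineK (outer_fin (V `&` ~` U))) outer_open; last first.
  exact: openI.
rewrite -EFinD lee_fin; apply/ler_addgt0Pr => d d0.
have d3 : 0 < d / 3 by rewrite divr_gt0.
have [f [cf fVU Lf]] := mass_adherent (V `&` U) d3.
pose K := [set e | d / 3 <= f e].
have KVU e : K e -> V e /\ U e.
  move=> Ke; apply: contrapT => nVU; have := fVU e.
  by rewrite indicE memNset// leNgt => /negP; apply; exact: lt_le_trans Ke.
have [g [cg gVK Lg]] := mass_adherent (V `&` ~` K) d3.
have : fine (outer_mass (V `&` ~` U)) <= open_mass (V `&` ~` K).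
  rewrite -lee_fin fineK//; apply: outer_ub.
    by apply: openI => //; rewrite openC; exact: closed_level.
  by move=> e [Ve nUe]; split => // /KVU[].
have : L (f + g) <= open_mass V + d / 3.
  apply: mass_shift; first exact: add_cont.
  move=> e; rewrite fctE; have [Ke|nKe] := pselect (K e).
    have [Ve Ue] := KVU e Ke.
    have := gVK e; have := fVU e; rewrite !indicE (mem_set Ve).
    rewrite (memNset (A := V `&` ~` K)); last by move=> [_].
    case: (_ \in _) => /=; lra.
  have := gVK e; have /negP := nKe; rewrite -ltNge !indicE in_setI.
  by case: (e \in V) => /=; case: (e \in ~` K) => /=; lra.
rewrite LD//; lra.
Qed.

(** The outer mass of [X] is an infimum over open [V] containing [X], so the splitting of open [V]
    suffices. *)
Let open_caratheodory U : open U -> outer_mass.-caratheodory U.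
Proof.
move=> oU; apply: le_caratheodory_measurable => X.
rewrite /outer_mass; apply: le_ereal_inf_tmp => _ [V [oV XV] <-].
apply: le_trans (outer_split oU oV).
by apply: leeD; apply: outer_le; exact: setSI.
Qed.


Let borel_caratheodory (B : set (borel E)) :
  measurable B -> outer_mass.-caratheodory B.
Proof.
move: B; apply: smallest_sub; last exact: open_caratheodory.
exact: (@sigma_algebra_measurable _ (caratheodory_type outer_mass)).
Qed.

(** * The Riesz measure and its regularity *)

Definition riesz_measure : set (borel E) -> \bar R := outer_mass.

Let riesz_additive : semi_sigma_additive riesz_measure.
Proof.
move=> F mF tF mUF.
apply: (@caratheodory_measure_sigma_additive R E outer_mass) => //.
  by move=> i; exact: borel_caratheodory.
exact: borel_caratheodory.
Qed.

HB.instance Definition _ := isMeasure.Build _ (borel E) R riesz_measure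
  outer0 outer_ge0 riesz_additive.

Let riesz_setT : riesz_measure setT = 1%E.
Proof. by rewrite /riesz_measure outer_open ?massT//; exact: openT. Qed.

HB.instance Definition _ :=
  Measure_isProbability.Build _ (borel E) R riesz_measure riesz_setT.

Let borel_open U : open U -> measurable (U : set (borel E)).
Proof. exact: sub_sigma_algebra. Qed.

Let borel_closed (K : set E) : closed K -> measurable (K : set (borel E)).
Proof.
move=> cK; rewrite -[K]setCK; apply: measurableC; apply: borel_open.
by rewrite openC.
Qed.

Let riesz_outer_regular (B : set (borel E)) : riesz_measure B =
  ereal_inf [set riesz_measure U | U in [set U : set E | open U /\ B `<=` U]].
Proof.
rewrite {1}/riesz_measure/outer_mass; congr ereal_inf.
by apply/seteqP; split => _ [U [oU BU] <-]; exists U => //;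
  rewrite /riesz_measure outer_open.
Qed.

Lemma riesz_regular : regular riesz_measure.
Proof.
move=> B mB; split; first exact: riesz_outer_regular.
apply/eqP; rewrite eq_le; apply/andP; split; last first.
  apply: ge_ereal_sup => _ [K [cK KB] <-].
  by apply: outer_le.
apply/lee_addgt0Pr => d d0.
have [U [oU BU]] := outer_adherent (~` B) d0.
rewrite -outer_open// => muU.
have mU : measurable (U : set (borel E)) by exact: borel_open.
have muUC : outer_mass (~` U) = (1 - outer_mass U)%E.
  exact: (@probability_setC _ _ _ riesz_measure _ mU).
have muBC : outer_mass (~` B) = (1 - outer_mass B)%E.
  exact: (@probability_setC _ _ _ riesz_measure _ mB).
apply: (@le_trans _ _ (outer_mass (~` U) + d%:E)%E); last first.
  rewrite leeD2r//; apply: ereal_sup_ubound; exists (~` U) => //; split.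
    apply: (subclosed_compact _ E_compact) => //; exact: open_closedC.
  by rewrite -[B]setCK; exact: subsetC.
rewrite [leLHS](_ : _ = outer_mass B)//.
move: muU; rewrite muUC muBC.
rewrite -[outer_mass U]fineK ?outer_fin// -[outer_mass B]fineK ?outer_fin//.
by rewrite -!EFinB -!EFinD !lee_fin; clear muUC muBC; lra.
Qed.

(** * Continuous majorants of upper semicontinuous functions *)

Lemma riesz_closed (K : set E) (d : R) : closed K -> 0 < d ->
  exists f, [/\ continuous f, forall e, (\1_K e : R) <= f e
    & L f <= fine (riesz_measure K) + d].
Proof.
move=> cK d0; have oK : open (~` K) by rewrite openC.
have [f [cf fK Lf]] := mass_adherent (~` K) d0.
(* One minus a near-optimal competitor for the complement of [K]. *)
exists (cst 1 + (- 1 : R) *: f); split.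
- by apply: add_cont => //; exact: scale_cont.
- move=> e; have := fK e; rewrite !fctE/= scaleN1r !indicE in_setC.
  by case: (e \in K) => /=; lra.
- have : outer_mass (~` ~` K) = (1 - outer_mass (~` K))%E.
    exact: (@probability_setC _ _ _ riesz_measure _ (borel_open oK)).
  rewrite setCK /riesz_measure => ->.
  rewrite outer_open// LD ?LZ ?L_cst//; last exact: scale_cont.
  by rewrite -EFinB/=; lra.
Qed.


(** Adds up the majorants from [riesz_closed], each at cost [c]. Integrability is part of the
    induction, since additivity of the integral uses it. *)
Let riesz_staircase (K : nat -> set (borel E)) N (c : R) :
  (forall k, closed (K k : set E)) -> 0 < c ->
  riesz_measure.-integrable setT (EFin \o staircase R K N) /\
  exists f, [/\ continuous f, forall e, staircase R K N e <= f e
    & L f <= \int[riesz_measure]_e staircase R K N e + N%:R * c].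
Proof.
move=> cK c0; elim: N => [|N [iS [f [cf Sf Lf]]]].
  have -> : staircase R K 0 = cst 0.
    by apply/funext => e; rewrite /staircase big_ord0.
  split; first exact: finite_measure_integrable_cst.
  by exists (cst 0); split => //; rewrite Rintegral_cst// !mul0r addr0 L_cst.
have [h [ch Kh Lh]] := riesz_closed (cK N) c0.
have mK : measurable (K N) by exact: borel_closed.
have i1 : riesz_measure.-integrable setT (EFin \o (\1_(K N) : borel E -> R)).
  exact: integrable_indic.
have -> : staircase R K N.+1 = fun e => staircase R K N e + \1_(K N) e.
  by apply/funext => e; rewrite /staircase big_ord_recr.
split; first exact: (integrableD _ iS i1).
exists (f + h); split; first exact: add_cont.
  by move=> e; rewrite fctE lerD.
rewrite LD// RintegralD//.
have -> : \int[riesz_measure]_e \1_(K N) e = fine (riesz_measure (K N)).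
  by rewrite /Rintegral integral_indic ?setIT.
rewrite -natr1; lra.
Qed.

(* [g] is within [b] of [- M] plus [b] times the number of [k < N] for which
   [g >= - M + k b], and these level sets are closed. *)
Lemma riesz_usc (g : E -> R) (d : R) : upper_semicontinuous g ->
  [bounded g e | e in setT] -> 0 < d ->
  exists f, [/\ continuous f, forall e, g e <= f e
    & L f <= \int[riesz_measure]_e g e + d].
Proof.
move=> ug bg d0; have [M1 [_ bM]] := bg; pose M := M1 + 1.
have gM e : - M <= g e <= M by rewrite -ler_norml bM// ltrDl.
(* One half of [d] pays for the step height of the staircase, the other for its continuous
   majorant. *)
pose b := d / 2; have b0 : 0 < b by rewrite divr_gt0.
have M0 : 0 <= M by have := gM point; lra.
(* Makes truncation harmless: if the count is [N], then [S * b] is at least [2 * M], hence at least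
   [g + M]. *)
pose N := Num.bound (2 * M / b).
have NM : 2 * M <= N%:R * b.
  rewrite -ler_pdivrMr//; apply/ltW/archi_boundP.
  by apply: divr_ge0; [exact: mulr_ge0|exact: ltW].
pose K k := [set e | - M + k%:R * b <= g e].
have cK k : closed (K k) by exact: usc_closed.
(* With this cost per level the [N] majorants lose at most 1 in total, hence at most [b] after
   scaling; the successor covers [N = 0]. *)
have c0 : 0 < N.+1%:R^-1 :> R by rewrite invr_gt0.
have [iS [f [cf Sf Lf]]] := riesz_staircase N cK c0.
set S : borel E -> R := staircase R K N in iS Sf Lf.
have SE e : [/\ S e * b <= (g e + M) + b & (g e + M) <= S e * b].
  have gM0 : 0 <= g e + M by have := gM e; lra.
  have [] := staircase_bounds N b0 gM0.
  have -> : \sum_(k < N) (k%:R * b <= g e + M)%R%:R = S e.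
    apply: eq_bigr => k _; rewrite indicE; congr (_%:R).
    congr nat_of_bool; apply/idP/idP.
      by move=> ?; apply/mem_set; rewrite /K /=; lra.
    by move=> /set_mem; rewrite /K /=; lra.
  move=> _ ? [?|SN]; split => //.
  by rewrite SN; have := gM e; lra.
have ig := usc_integrable riesz_measure ug bg.
have ic : riesz_measure.-integrable setT (EFin \o (cst (M + b) : borel E -> R)).
  exact: finite_measure_integrable_cst.
exists (cst (- M) + b *: f); split.
- by apply: add_cont => //; exact: scale_cont.
- move=> e; have [_] := SE e.
  change (g e + M <= S e * b -> g e <= - M + b * f e).
  by have := Sf e; rewrite -(ler_pM2r b0); lra.
rewrite LD ?LZ ?L_cst//; last exact: scale_cont.
have : \int[riesz_measure]_e (b * S e) <= \int[riesz_measure]_e (g e + (M + b)).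
  apply: le_Rintegral => //.
  - exact: (integrableZl _ b iS).
  - exact: (integrableD _ ig ic).
  - by move=> e _; have [] := SE e; lra.
rewrite RintegralZl// RintegralD// Rintegral_cst//.
rewrite [fine _](_ : _ = 1) ?mulr1; last exact: (congr1 fine riesz_setT).
have : b * L f <= b * (\int[riesz_measure]_e S e + 1).
  by rewrite ler_pM2l// (le_trans Lf)// lerD2l ler_pdivrMr// mul1r ler_nat.
rewrite mulrDr mulr1 /b; lra.
Qed.

(* For continuous [g], the inequality applied to [g] and to [- g] yields that
   [L g] is the integral of [g]. *)
Lemma riesz_markov_usc : exists mu : probability (borel E) R, regular mu /\
  forall (g : E -> R) (d : R), upper_semicontinuous g ->
    [bounded g e | e in setT] -> 0 < d ->
    exists f, [/\ continuous f, forall e, g e <= f e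
      & L f <= \int[mu]_e g e + d].
Proof.
exists riesz_measure; split; first exact: riesz_regular.
by move=> g d; exact: riesz_usc.
Qed.

End riesz.

(** * Supergradients of the envelope *)

Section envelope.
Context {R : realType} {X : Type} {E : ptopologicalType}.
Hypothesis E_compact : compact [set: E].
Variables (x : X) (phi : E -> R^o) (tr : (X -> R^o) -> E -> R).
Variable A : set (X -> R^o).
Hypotheses (phi_continuous : continuous phi)
  (A_convex : convex_set A)
  (tr_convex : forall u v (t : R), A u -> A v -> 0 <= t <= 1 -> forall e,
    tr (t *: u + (1 - t) *: v) e <= t * tr u e + (1 - t) * tr v e)
  (A_addcst : forall u (a : R), A u -> A (u + cst a))
  (tr_addcst : forall u (a : R), A u -> forall e,
    tr (u + cst a) e = tr u e + a)
  (envelope_finite : envelope tr x A phi \is a fin_num).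
Implicit Types (f g h : E -> R^o) (u v : X -> R^o).

Let values f := [set u x | u in [set u | A u /\ forall e, tr u e <= f e]].
(** A supremum in [R], with a default value on empty or unbounded sets; [has_sup_values] rules these
    out for continuous [f]. *)
Let q f : R := sup (values f).

Let envelopeE f : envelope tr x A f = ereal_sup (EFin @` values f).
Proof. by rewrite /envelope /values image_comp. Qed.

Let has_sup_phi : has_sup (values phi).
Proof.
have V0 : values phi !=set0.
  apply/set0P/eqP => V0; move: envelope_finite.
  by rewrite envelopeE V0 image_set0 ereal_sup0.
split => //; apply: contrapT => nub; move: envelope_finite.
by rewrite envelopeE hasNub_ereal_sup.
Qed.

Lemma envelope_sup : envelope tr x A phi = (q phi)%:E.
Proof. by rewrite envelopeE; apply: ereal_sup_EFin; case: has_sup_phi. Qed.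

Let values_shift f g (a : R) r : (forall e, f e + a <= g e) ->
  values f r -> values g (r + a).
Proof.
move=> fg [u [Au uf] <-]; exists (u + cst a) => //.
split; first exact: A_addcst.
by move=> e; rewrite tr_addcst// (le_trans _ (fg e))// lerD2r.
Qed.

(** [f] and [phi] differ by at most [M + N], so adding constants to members of [A] carries
    finiteness over from [phi]. *)
Let has_sup_values f : continuous f -> has_sup (values f).
Proof.
move=> cf; have [M fM] := continuous_bounded E_compact cf.
have [N pN] := continuous_bounded E_compact phi_continuous.
have [[r Vr] [m Vm]] := has_sup_phi.
split.
  exists (r - (M + N)); apply: (values_shift _ Vr) => e.
  have := fM e; have := pN e; rewrite !ler_norml; lra.
exists (m + (M + N)) => s Vs; rewrite -lerBlDr; apply: Vm.
apply: (values_shift _ Vs) => e.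
by have := fM e; have := pN e; rewrite !ler_norml; lra.
Qed.

Let q_ub f u : continuous f -> A u -> (forall e, tr u e <= f e) -> u x <= q f.
Proof.
by move=> cf Au uf; apply: ub_le_sup; [case: (has_sup_values cf)|exists u].
Qed.

Let q_adherent f (d : R) : continuous f -> 0 < d ->
  exists u, [/\ A u, forall e, tr u e <= f e & q f <= u x + d].
Proof.
move=> cf d0; have [_ [u [Au uf] <-] lt] := sup_adherent d0 (has_sup_values cf).
by exists u; split => //; rewrite -lerBlDr ltW.
Qed.

Let q_shift f g (a : R) : continuous f -> continuous g ->
  (forall e, f e + a <= g e) -> q f + a <= q g.
Proof.
move=> cf cg fg; apply/ler_addgt0Pr => d d0.
have [u [Au uf qu]] := q_adherent cf d0.
have : (u + cst a) x <= q g.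
  apply: q_ub => //; first exact: A_addcst.
  by move=> e; rewrite tr_addcst// (le_trans _ (fg e))// lerD2r.
by rewrite fctE /=; lra.
Qed.

(** The convex combination of near-optimal [u] and [v] is a competitor for [h], by convexity of [A]
    and of the trace. *)
Let q_concave f g h (t : R) : continuous f -> continuous g -> continuous h ->
  0 <= t <= 1 -> (forall e, h e = t * f e + (1 - t) * g e) ->
  t * q f + (1 - t) * q g <= q h.
Proof.
move=> cf cg ch /[dup] t01 /andP[t0 t1] hfg; apply/ler_addgt0Pr => d d0.
have [u [Au uf qu]] := q_adherent cf d0.
have [v [Av vg qv]] := q_adherent cg d0.
have Auv : A (t *: u + (1 - t) *: v).
  apply: set_mem; have := A_convex (Itv01 t0 t1) (mem_set Au) (mem_set Av).
  by rewrite /conv.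
have : (t *: u + (1 - t) *: v) x <= q h.
  apply: q_ub => // e; rewrite hfg (le_trans (tr_convex Au Av t01 e))//.
  by have := uf e; have := vg e; nra.
change (t * u x + (1 - t) * v x <= q h -> t * q f + (1 - t) * q g <= q h + d).
nra.
Qed.

(** [G h = q phi - q (phi - h)] is convex and vanishes at 0. A linear [L] below [G], evaluated at
    [h = phi - f], gives [q f <= q phi - L phi + L f]. *)
Lemma envelope_supergradient : exists L : (E -> R^o) -> R, mean L /\
  forall f u, continuous f -> A u -> (forall e, tr u e <= f e) ->
    u x <= q phi - L phi + L f.
Proof.
have c0 : continuous (cst 0 : E -> R^o) by move=> e; exact: cvg_cst.
have cZ (a : R) f : continuous f -> continuous (a *: f).
  by move=> cf e; apply: (@continuousZl_tmp R R^o); exact: cf.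
have clin (a : R) f g : continuous f -> continuous g -> continuous (a *: f + g).
  by move=> cf cg e; apply: cvgD; [exact: cZ|exact: cg].
have cB f g : continuous f -> continuous g -> continuous (f - g).
  by move=> cf cg; rewrite addrC -scaleN1r; exact: clin.
pose G h := q phi - q (phi - h).
have G0 : G 0 = 0 by rewrite /G subr0 subrr.
have cG : convex_on [set f | continuous f] G.
  move=> f g t cf cg t01; rewrite /G.
  have := @q_concave (phi - f) (phi - g) (phi - (t *: f + (1 - t) *: g)) t.
  move=> /(_ (cB _ _ phi_continuous cf) (cB _ _ phi_continuous cg)).
  have cfg : continuous (t *: f + (1 - t) *: g).
    by apply: clin => //; exact: cZ.
  move=> /(_ (cB _ _ phi_continuous cfg) t01) => H.
  have /H : forall e, (phi - (t *: f + (1 - t) *: g)) e =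
      t * (phi - f) e + (1 - t) * (phi - g) e.
    move=> e.
    change (phi e - (t * f e + (1 - t) * g e) =
      t * (phi e - f e) + (1 - t) * (phi e - g e)); ring.
  lra.
have [L [LD LZ LG]] := convex_linear_minorant clin c0 cG G0.
have LB f g : continuous f -> continuous g -> L (f - g) = L f - L g.
  move=> cf cg; rewrite -scaleN1r LD// ?LZ ?mulN1r//.
  exact: cZ.
have c1 : continuous (cst 1 : E -> R^o) by move=> e; exact: cvg_cst.
exists L; split; first split => //.
(* For [f <= g], monotonicity of [q] makes [G (f - g)] nonpositive. *)
- move=> f g cf cg fg; rewrite -subr_le0 -LB//; apply: le_trans (LG _ _) _.
    exact: cB.
  rewrite /G subr_le0 -[leLHS]addr0; apply: q_shift => //.
    exact: (cB _ _ phi_continuous (cB _ _ cf cg)).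
  move=> e; change (phi e + 0 <= phi e - (f e - g e)).
  by have := fg e; lra.
(* Since [q] commutes with constants, [L <= G] at the constants 1 and -1 gives the two
   inequalities. *)
- apply/eqP; rewrite eq_le; apply/andP; split.
    apply: le_trans (LG _ c1) _; rewrite /G lerBlDl -lerBlDr.
    apply: q_shift => //; first exact: cB.
  have : L (0 - cst 1) <= G (0 - cst 1) by apply: LG; exact: cB.
  rewrite LB// -[X in L X - _](scale0r 0) LZ// mul0r sub0r lerNl => H.
  apply: le_trans _ H; rewrite /G opprB lerBrDl.
  apply: q_shift => //; first exact: (cB _ _ phi_continuous (cB _ _ c0 c1)).
  by move=> e; change (phi e + 1 <= phi e - (0 - 1)); lra.
- move=> f u cf Au uf; apply: (le_trans (q_ub cf Au uf)).
  have := LG _ (cB _ _ phi_continuous cf).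
  by rewrite LB// /G subKr; lra.
Qed.

End envelope.

(** * Duality between the envelope and the Jensen measures *)

Unset Implicit Arguments.

Theorem theorem2p4 (R : realType) (X : Type) (x : X) (E : ptopologicalType)
    (E_compact : compact [set: E]) (E_hausdorff : hausdorff_space E)
    (phi : E -> R) (phi_continuous : continuous phi)
    (tr : (X -> R^o) -> E -> R) (A F : set (X -> R^o))
    (A_nonempty : A !=set0) (F_cone : convex_cone F)
    (tr_bounded : forall u, A u \/ F u -> [bounded tr u e | e in [set: E]])
    (tr_usc : forall u, A u \/ F u -> upper_semicontinuous (tr u))
    (A_convex : convex_set A)
    (tr_convex : forall u v (t : R), A u -> A v -> 0 <= t <= 1 -> forall e,
      tr (t *: u + (1 - t) *: v) e <= t * tr u e + (1 - t) * tr v e)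
    (A_addcst : forall u (a : R), A u -> A (u + cst a))
    (tr_addcst : forall u (a : R), A u -> forall e,
      tr (u + cst a) e = tr u e + a)
    (A_addcone : forall u v (t : R), A u -> F v -> 0 <= t -> A (u + t *: v))
    (tr_addcone : forall u v (t : R), A u -> F v -> 0 <= t -> forall e,
      tr (u + t *: v) e <= tr u e + t * tr v e)
    (envelope_finite : envelope tr x A phi \is a fin_num) :
  envelope tr x A phi =
  ereal_inf [set (\int[mu]_e (phi e)%:E - jensen_deficit tr x A mu)%E
            | mu in jensen_measures tr x F].
Proof.
have bphi : [bounded phi e | e in [set: E]].
  have [M phiM] := continuous_bounded E_compact phi_continuous.
  by exists M; split => [|N MN e _]; [exact: num_real|exact: le_trans (ltW MN)].
have uphi : upper_semicontinuous phi by exact: continuous_usc.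
have integralE (mu : probability (borel E) R) u : A u \/ F u ->
    (\int[mu]_e (tr u e)%:E)%E = (\int[mu]_e tr u e)%:E.
  by move=> AFu; apply: integral_usc; [exact: tr_usc|exact: tr_bounded].
have integral_phi (mu : probability (borel E) R) :
    (\int[mu]_e (phi e)%:E)%E = (\int[mu]_e phi e)%:E.
  exact: integral_usc.
apply/eqP; rewrite eq_le; apply/andP; split.
  (* Weak duality: a competitor [u] of the envelope is also tested in the deficit, and its trace is
     below [phi]. *)
  apply: le_ereal_inf_tmp => _ [mu muJ <-].
  apply: ge_ereal_sup => _ [u [Au uphi_le] <-].
  have : (jensen_deficit tr x A mu <= (\int[mu]_e phi e - u x)%:E)%E.
    apply: ge_ereal_inf; exists (\int[mu]_e (tr u e)%:E - (u x)%:E)%E.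
      by exists u.
    rewrite integralE; last by left.
    rewrite -EFinB lee_fin lerD2r; apply: le_Rintegral => //.
    - by apply: usc_integrable; [apply: tr_usc; left|apply: tr_bounded; left].
    - exact: usc_integrable.
  rewrite -leeN2 => /(leeD2l (\int[mu]_e (phi e)%:E)%E) H; apply: le_trans H.
  by rewrite integral_phi -EFinN -EFinD opprB addrC subrK.
rewrite (envelope_sup envelope_finite).
have [L [L_mean Lq]] := envelope_supergradient E_compact phi_continuous A_convex
  tr_convex A_addcst tr_addcst envelope_finite.
set q := sup _ in Lq *.
have [mu [mu_regular muL]] := riesz_markov_usc E_compact E_hausdorff L_mean.
(* A continuous majorant [f] of [- phi] with nearly the same integral gives [- L phi <= L f]. *)
have L_phi : \int[mu]_e phi e <= L phi.
  have cN : continuous (- phi : E -> R^o).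
    by move=> e; apply: cvgN; exact: phi_continuous.
  have bN : [bounded (- phi : E -> R^o) e | e in [set: E]].
    exact: bounded_funN.
  apply/ler_addgt0Pr => d d0.
  have [f [cf Nf Lf]] := muL _ d (continuous_usc cN) bN d0.
  case: L_mean => _ LZ L_le _.
  have := L_le _ _ cN cf Nf; rewrite -scaleN1r LZ// mulN1r => Lphi.
  have : \int[mu]_e (- phi : E -> R^o) e = - \int[mu]_e phi e.
    under eq_Rintegral do rewrite -scaleN1r.
    by rewrite RintegralZl ?mulN1r//; exact: usc_integrable.
  lra.
(* The supergradient inequality at a continuous majorant of the trace, with [L phi] bounded below by
   the integral of [phi]. *)
have key u : A u -> u x <= q - \int[mu]_e phi e + \int[mu]_e tr u e.
  move=> Au; apply/ler_addgt0Pr => d d0.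
  have [f [cf uf Lf]] := muL (tr u) d (tr_usc u (or_introl Au))
    (tr_bounded u (or_introl Au)) d0.
  by have := Lq f u cf Au uf; lra.
have [u0 Au0] := A_nonempty.
have muJ : jensen_measures tr x F mu.
  split => // v Fv; rewrite integralE; last by right.
  rewrite lee_fin leNgt; apply/negP => gap.
  set c := q - \int[mu]_e phi e + \int[mu]_e tr u0 e - u0 x.
  set b := v x - \int[mu]_e tr v e.
  have b0 : 0 < b by rewrite subr_gt0.
  (* [key] along the ray [u0 + t *: v]: each unit of [t] costs the violation [b] of the Jensen
     inequality, while the slack [c] at [u0] is fixed. *)
  have bound t : 0 <= t -> t * b <= c.
    move=> t0; have := key _ (A_addcone _ _ _ Au0 Fv t0).
    have i0 := usc_integrable mu (tr_usc u0 (or_introl Au0))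
      (tr_bounded u0 (or_introl Au0)).
    have iv := usc_integrable mu (tr_usc v (or_intror Fv))
      (tr_bounded v (or_intror Fv)).
    have itv : mu.-integrable setT (EFin \o (fun e : borel E => t * tr v e)).
      exact: (integrableZl _ t iv).
    have : \int[mu]_e tr (u0 + t *: v) e <=
        \int[mu]_e (tr u0 e + t * tr v e).
      apply: le_Rintegral => //.
      - apply: usc_integrable; [apply: tr_usc|apply: tr_bounded];
          by left; exact: A_addcone.
      - exact: (integrableD _ i0 itv).
      - by move=> e _; exact: tr_addcone.
    rewrite RintegralD// RintegralZl// => le1.
    change (u0 x + t * v x <= q - \int[mu]_e phi e +
      \int[mu]_e tr (u0 + t *: v) e -> t * b <= c).
    rewrite /b /c mulrBr; lra.
  have c0 : 0 <= c by rewrite -(mul0r b); exact: bound.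
  (* This value of [t] would give [c + b <= c]. *)
  have : (c / b + 1) * b <= c.
    by apply: bound; rewrite addr_ge0// divr_ge0// ltW.
  by rewrite mulrDl mul1r divfK ?gt_eqF//; lra.
apply: ge_ereal_inf.
exists (\int[mu]_e (phi e)%:E - jensen_deficit tr x A mu)%E; first by exists mu.
(* Taking the infimum of [key] over [A] bounds the deficit from below. *)
have : ((\int[mu]_e phi e - q)%:E <= jensen_deficit tr x A mu)%E.
  apply: le_ereal_inf_tmp => _ [u Au <-].
  rewrite integralE; last by left.
  by rewrite -EFinB lee_fin; have := key u Au; lra.
rewrite -leeN2 => /(leeD2l (\int[mu]_e (phi e)%:E)%E)/le_trans; apply.
by rewrite integral_phi -EFinN -EFinD opprB addrC subrK.
Qed.
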